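(* Let $n,m,T\ge 1$, let $A_s\in\mathbb{R}^{n\times n}$, $B_s\in\mathbb{R}^{n\times m}$, and let the data $(U_-,X)$ be generated by the system $x(t+1)=A_sx(t)+B_su(t)$ (i.e. without noise) for $t=0,\dots,T-1$, with $X_-,X_+,U_-$ the associated data matrices, so that $X_+=A_sX_-+B_sU_-$. Then $(U_-,X)$ are informative for stabilization by state feedback if and only if there exist $P=P^\top\in\mathbb{R}^{n\times n}$ with $P>0$, $L\in\mathbb{R}^{m\times n}$, and a scalar $\beta>0$ satisfying $$\begin{bmatrix} P-\beta I & 0 & 0 & 0\\ 0 & -P & -L^\top & 0\\ 0 & -L & 0 & L\\ 0 & 0 & L^\top & P\end{bmatrix}+\begin{bmatrix} X_+\\ -X_-\\ -U_-\\ 0\end{bmatrix}\begin{bmatrix} X_+\\ -X_-\\ -U_-\\ 0\end{bmatrix}^\top\ge 0. \qquad ( * )$$ Moreover, if $P=P^\top>0$ and $L$ satisfy $( * )$ (for some $\beta>0$), then $K:=LP^{-1}$ is a stabilizing feedback gain for all $(A,B)\in\Sigma$, i.e. $A+BK$ is Schur stable for all $(A,B)\in\Sigma$.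
   Context: Data matrices: given states $x(0),\dots,x(T)\in\mathbb{R}^n$ and inputs $u(0),\dots,u(T-1)\in\mathbb{R}^m$, $X=[x(0)\ x(1)\ \cdots\ x(T)]$, $X_-=[x(0)\ \cdots\ x(T-1)]\in\mathbb{R}^{n\times T}$, $X_+=[x(1)\ \cdots\ x(T)]\in\mathbb{R}^{n\times T}$, $U_-=[u(0)\ \cdots\ u(T-1)]\in\mathbb{R}^{m\times T}$. The set of systems explaining the data is $\Sigma:=\{(A,B)\in\mathbb{R}^{n\times n}\times\mathbb{R}^{n\times m}\mid X_+=AX_-+BU_-\}$. The data $(U_-,X)$ are called informative for stabilization by state feedback if there exists $K\in\mathbb{R}^{m\times n}$ such that $A+BK$ is Schur stable for all $(A,B)\in\Sigma$ (a single $K$ for all systems in $\Sigma$). A square matrix is Schur stable if all its eigenvalues have modulus strictly less than $1$. For a real symmetric matrix $S$, $S>0$ ($S\ge0$) means positive definite (positive semidefinite). The blocks in the matrix inequality have sizes $n,n,m,n$. *)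

(* Defs.v *)
From HB Require Import structures.
From mathcomp Require Import all_boot all_order all_algebra.
From mathcomp Require Import complex.
From mathcomp Require Import reals.

Set Implicit Arguments.
Unset Strict Implicit.
Unset Printing Implicit Defensive.

Import Order.TTheory GRing.Theory Num.Theory.
Local Open Scope ring_scope.

Definition posdefmx (R : realType) (k : nat) (S : 'M[R]_k) : Prop :=
  S^T = S /\ forall v : 'cV[R]_k, v != 0 -> 0 < (v^T *m S *m v) 0 0.

Definition possemidefmx (R : realType) (k : nat) (S : 'M[R]_k) : Prop :=
  S^T = S /\ forall v : 'cV[R]_k, 0 <= (v^T *m S *m v) 0 0.

(* The eigenvalues are the complex ones. For z in R[i], `|z| lies in R[i] with
   zero imaginary part, so `|z| < 1 is the usual comparison of the modulus. *)
Definition schur_stable (R : realType) (n : nat) (M : 'M[R]_n) : Prop :=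
  forall z : R[i], eigenvalue (map_mx (real_complex R) M) z -> `|z| < 1.

Section Data.
Variables (R : realType) (n m T : nat).

Definition state_data (x : 'I_T.+1 -> 'cV[R]_n) : 'M[R]_(n, T.+1) :=
  \matrix_(i, t) x t i 0.

Definition input_data (u : 'I_T -> 'cV[R]_m) : 'M[R]_(m, T) :=
  \matrix_(i, t) u t i 0.

Definition Xminus (X : 'M[R]_(n, T.+1)) : 'M[R]_(n, T) :=
  colsub (widen_ord (leqnSn T)) X.

Definition Xplus (X : 'M[R]_(n, T.+1)) : 'M[R]_(n, T) :=
  colsub (lift ord0) X.

(* The set Sigma of systems explaining the data, as a predicate on (A, B). *)
Definition explains (U : 'M[R]_(m, T)) (X : 'M[R]_(n, T.+1))
    (A : 'M[R]_n) (B : 'M[R]_(n, m)) : Prop :=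
  Xplus X = A *m Xminus X + B *m U.

Definition stabilizes_all (U : 'M[R]_(m, T)) (X : 'M[R]_(n, T.+1))
    (K : 'M[R]_(m, n)) : Prop :=
  forall (A : 'M[R]_n) (B : 'M[R]_(n, m)),
    explains U X A B -> schur_stable (A + B *m K).

Definition informative_for_stabilization
    (U : 'M[R]_(m, T)) (X : 'M[R]_(n, T.+1)) : Prop :=
  exists K : 'M[R]_(m, n), stabilizes_all U X K.

Definition lmi_block (P : 'M[R]_n) (L : 'M[R]_(m, n)) (beta : R) :
    'M[R]_(n + (n + (m + n))) :=
  col_mx    (row_mx (P - beta%:M) (row_mx 0      (row_mx 0        0)))
  (col_mx   (row_mx 0             (row_mx (- P)  (row_mx (- L^T)  0)))
   (col_mx  (row_mx 0             (row_mx (- L)  (row_mx 0        L)))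
            (row_mx 0             (row_mx 0      (row_mx L^T      P))))).

Definition lmi_data (U : 'M[R]_(m, T)) (X : 'M[R]_(n, T.+1)) :
    'M[R]_(n + (n + (m + n)), T) :=
  col_mx (Xplus X) (col_mx (- Xminus X) (col_mx (- U) 0)).

Definition stabilization_lmi (U : 'M[R]_(m, T)) (X : 'M[R]_(n, T.+1))
    (P : 'M[R]_n) (L : 'M[R]_(m, n)) (beta : R) : Prop :=
  possemidefmx (lmi_block P L beta + lmi_data U X *m (lmi_data U X)^T).

End Data.

(* Main.v *)
(* With [L = K P], the quadratic form of the matrix in the inequality at the
   vector [(a, b, c, d)] is, writing [|v|_P^2 = v^T P v],
     |a|_P^2 - beta |a|^2 - |b + K^T c|_P^2 + |d + K^T c|_P^2 + |e|^2,
   where [e = X_+^T a - X_-^T b - U_-^T c].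
   If it is nonnegative, then [a = w], [b = A^T w], [c = B^T w],
   [d = - K^T B^T w] gives [e = 0] for every system explaining the data, and
   what remains is the Lyapunov inequality for [A + B K].
   Conversely, if [K] stabilizes all these systems, then [1 = X_- G] and
   [K = U_- G] for some [G], so that [b + K^T c = M^T a - G^T e] with
   [M = As + Bs K]. For [P] solving the strict Lyapunov inequality of [M], the
   first three terms are bounded below by a multiple of [- |e|^2], which
   [|e|^2] dominates once [P] is scaled down. *)
Require Import Defs.
From HB Require Import structures.
From mathcomp Require Import all_boot all_order all_algebra.
From mathcomp Require Import complex.
From mathcomp Require Import reals.
From mathcomp Require Import ring lra.

Set Implicit Arguments.
Unset Strict Implicit.
Unset Printing Implicit Defensive.

Import Order.TTheory GRing.Theory Num.Theory.
Local Open Scope ring_scope.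

(** * Entrywise matrix norm *)

(** The entries range over any [numDomainType], so that one norm serves real matrices and their
    complex images. *)
Definition l1norm (R : numDomainType) (m n : nat) (A : 'M[R]_(m, n)) : R :=
  \sum_i \sum_j `|A i j|.

Lemma l1norm_ge0 (R : numDomainType) m n (A : 'M[R]_(m, n)) : 0 <= l1norm A.
Proof. by apply: sumr_ge0 => i _; apply: sumr_ge0. Qed.

Lemma l1normD (R : numDomainType) m n (A B : 'M[R]_(m, n)) :
  l1norm (A + B) <= l1norm A + l1norm B.
Proof.
rewrite -big_split; apply: ler_sum => i _; rewrite -big_split.
by apply: ler_sum => j _; rewrite mxE ler_normD.
Qed.

Lemma l1normZ (R : numDomainType) m n (a : R) (A : 'M[R]_(m, n)) :
  l1norm (a *: A) = `|a| * l1norm A.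
Proof.
rewrite mulr_sumr; apply: eq_bigr => i _; rewrite mulr_sumr.
by apply: eq_bigr => j _; rewrite mxE normrM.
Qed.

Lemma l1norm_tr (R : numDomainType) m n (A : 'M[R]_(m, n)) :
  l1norm A^T = l1norm A.
Proof.
rewrite /l1norm exchange_big /=.
by apply: eq_bigr => i _; apply: eq_bigr => j _; rewrite mxE.
Qed.

Lemma l1normM (R : numDomainType) m n p (A : 'M[R]_(m, n)) (B : 'M[R]_(n, p)) :
  l1norm (A *m B) <= l1norm A * l1norm B.
Proof.
rewrite mulr_suml; apply: ler_sum => i _.
apply: (@le_trans _ _ (\sum_k `|A i k| * \sum_j `|B k j|)).
  under [leRHS]eq_bigr => k _ do rewrite mulr_sumr.
  rewrite exchange_big /=; apply: ler_sum => j _; rewrite mxE.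
  apply: le_trans (ler_norm_sum _ _ _) _.
  by apply: ler_sum => k _; rewrite normrM.
rewrite mulr_suml; apply: ler_sum => k _; apply: ler_wpM2l => //.
rewrite /l1norm (bigD1 k) //= lerDl.
by apply: sumr_ge0 => l _; apply: sumr_ge0.
Qed.

(** * Powers and trace of a Schur stable matrix *)

(* Peeling one root [z] off the annihilating polynomial turns the powers applied
   to [E] into the recurrence [s (k+1) = z s k + e k], where [e] is the same
   sequence for [(M - z) E]. *)
Lemma summable_powers_of_annihilator (F : numFieldType) n (M E : 'M[F]_n.+1)
    (rs : seq F) :
  all (fun z => `|z| < 1) rs ->
  horner_mx M (\prod_(z <- rs) ('X - z%:P)) *m E = 0 ->
  exists c : F, forall N, \sum_(k < N) l1norm (M ^+ k *m E) <= c.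
Proof.
elim: rs E => [|z rs IHrs] E /=.
  rewrite big_nil rmorph1 mul1mx => _ ->; exists 0 => N.
  rewrite big1 // => k _; rewrite mulmx0 /l1norm big1 // => i _.
  by rewrite big1 // => j _; rewrite mxE normr0.
case/andP=> z_lt1 rs_lt1.
rewrite big_cons mulrC rmorphM /= rmorphB /= horner_mx_X horner_mx_C.
rewrite -mulmxE -mulmxA => /(IHrs _ rs_lt1)[c sum_le].
exists ((l1norm E + c) / (1 - `|z|)) => N.
rewrite ler_pdivlMr ?subr_gt0 //.
set S := \sum_(k < N) _.
have step k : l1norm (M ^+ k.+1 *m E) <=
    `|z| * l1norm (M ^+ k *m E) + l1norm (M ^+ k *m ((M - z%:M) *m E)).
  rewrite -l1normZ; apply: le_trans (l1normD _ _).
  rewrite mulmxBl mulmxBr mul_scalar_mx -scalemxAr addrC subrK mulmxA.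
  by rewrite exprSr.
(* Adding the term of index [N] and splitting off that of index 0 leaves [N] shifted terms, to which
   [step] applies. Solving for [S] needs [|z| < 1]. *)
have : S <= l1norm E + (`|z| * S + c).
  apply: (@le_trans _ _ (\sum_(k < N.+1) l1norm (M ^+ k *m E))).
    by rewrite big_ord_recr /= lerDl l1norm_ge0.
  rewrite big_ord_recl /= expr0 mul1mx lerD2l.
  set e := fun k => l1norm (M ^+ k *m ((M - z%:M) *m E)).
  apply: (@le_trans _ _ (\sum_(k < N) (`|z| * l1norm (M ^+ k *m E) + e k))).
    by apply: ler_sum => k _; apply: step.
  by rewrite big_split /= -mulr_sumr lerD2l; apply: sum_le.
by rewrite mulrBr mulr1 lerBlDr -addrA [c + _]addrC [S * _]mulrC.
Qed.

Lemma char_poly_roots (F : closedFieldType) n (M : 'M[F]_n) :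
  exists2 rs : seq F, char_poly M = \prod_(z <- rs) ('X - z%:P) &
    size rs = n /\ all (eigenvalue M) rs.
Proof.
have [rs] := closed_field_poly_normal (char_poly M).
rewrite (monicP (char_poly_monic M)) scale1r => Mrs; exists rs => //; split.
  by have := size_char_poly M; rewrite Mrs size_prod_XsubC => -[].
by apply/allP => z zrs; rewrite eigenvalue_root_char Mrs root_prod_XsubC.
Qed.

(** By Cayley-Hamilton the eigenvalues give an annihilating polynomial, so the norms of the powers
    have bounded partial sums. Norms that all stayed above [eps] would make these sums grow
    linearly. *)
Lemma schur_stable_small_power (R : realType) n (M : 'M[R]_n.+1) (eps : R) :
  schur_stable M -> 0 < eps -> exists N, l1norm (M ^+ N) < eps.
Proof.
move=> stabM eps_gt0.
have [rs Mrs [_ rs_eig]] := char_poly_roots (map_mx (real_complex R) M).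
have rs_lt1 : all (fun z => `|z| < 1) rs.
  by apply/allP => z /(allP rs_eig)/stabM.
have [|c sum_le] := @summable_powers_of_annihilator _ _ 
  (map_mx (real_complex R) M) 1%:M _ rs_lt1.
  by rewrite -Mrs Cayley_Hamilton mul0mx.
have l1C k : l1norm (map_mx (real_complex R) M ^+ k) =
    (l1norm (M ^+ k))%:C%C.
  rewrite -rmorphXn /= /l1norm rmorph_sum; apply: eq_bigr => i _.
  rewrite rmorph_sum; apply: eq_bigr => j _.
  by rewrite mxE normc_def /= expr0n addr0 sqrtr_sqr.
have sumR N : \sum_(k < N) l1norm (M ^+ k) <= complex.Re c.
  have := sum_le N; under eq_bigr do rewrite mulmx1 l1C.
  by rewrite -rmorph_sum /= lecE => /andP[].
apply: boolp.contrapT => no_small.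
have big_l1 k : eps <= l1norm (M ^+ k).
  by rewrite leNgt; apply/negP => small; apply: no_small; exists k.
pose N := Num.bound (complex.Re c / eps).
have := sumR N; apply/negP; rewrite -ltNge.
apply: (@lt_le_trans _ _ (\sum_(k < N) eps)); last by apply: ler_sum.
rewrite sumr_const card_ord -mulr_natr -ltr_pdivrMl // mulrC.
apply: archi_boundP; rewrite divr_ge0 ?(ltW eps_gt0) //.
(* The empty partial sum shows that the bound is nonnegative. *)
by have := sumR 0%N; rewrite big_ord0.
Qed.

(** The trace is the sum of [n] complex eigenvalues of modulus below 1. *)
Lemma schur_stable_trace_le (R : realType) n (M : 'M[R]_n) :
  schur_stable M -> \tr M <= n%:R.
Proof.
case: n M => [|n] M stabM; first by rewrite /mxtrace big_ord0.
pose MC := map_mx (real_complex R) M.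
have [rs MCrs [sz_rs rs_eig]] := char_poly_roots MC.
have trE : \tr MC = \sum_(z <- rs) z.
  apply: oppr_inj; rewrite -char_poly_trace // MCrs -coefPn_prod_XsubC sz_rs //.
have : `|\tr MC| <= n.+1%:R.
  rewrite trE; apply: le_trans (ler_norm_sum _ _ _) _.
  rewrite -sz_rs -sum1_size natr_sum big_seq [leRHS]big_seq.
  by apply: ler_sum => z /(allP rs_eig)/stabM/ltW.
rewrite trace_map_mx /= normc_def /= expr0n addr0 sqrtr_sqr => tr_le.
apply: le_trans (ler_norm _) _.
by move: tr_le; rewrite -(rmorph_nat (real_complex R)) lecR.
Qed.

(** * Dot products and quadratic forms *)

Definition dotv (R : comNzRingType) (n : nat) (u v : 'cV[R]_n) : R :=
  (u^T *m v) 0 0.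

Lemma dotvE (R : comNzRingType) n (u v : 'cV[R]_n) :
  dotv u v = \sum_i u i 0 * v i 0.
Proof. by rewrite /dotv mxE; apply: eq_bigr => i _; rewrite mxE. Qed.

Lemma dotv0 (R : comNzRingType) n (u : 'cV[R]_n) : dotv u 0 = 0.
Proof. by rewrite /dotv mulmx0 mxE. Qed.

Lemma dotvC (R : comNzRingType) n (u v : 'cV[R]_n) : dotv u v = dotv v u.
Proof. by rewrite !dotvE; apply: eq_bigr => i _; rewrite mulrC. Qed.

Lemma dotvDr (R : comNzRingType) n (u v w : 'cV[R]_n) :
  dotv u (v + w) = dotv u v + dotv u w.
Proof. by rewrite /dotv mulmxDr mxE. Qed.

Lemma dotvNr (R : comNzRingType) n (u v : 'cV[R]_n) :
  dotv u (- v) = - dotv u v.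
Proof. by rewrite /dotv mulmxN mxE. Qed.

Lemma dotvZr (R : comNzRingType) n (a : R) (u v : 'cV[R]_n) :
  dotv u (a *: v) = a * dotv u v.
Proof. by rewrite /dotv -scalemxAr mxE. Qed.

Lemma dotvDl (R : comNzRingType) n (u v w : 'cV[R]_n) :
  dotv (u + v) w = dotv u w + dotv v w.
Proof. by rewrite -!(dotvC w) dotvDr. Qed.

Lemma dotvNl (R : comNzRingType) n (u v : 'cV[R]_n) :
  dotv (- u) v = - dotv u v.
Proof. by rewrite -!(dotvC v) dotvNr. Qed.

Lemma dotvZl (R : comNzRingType) n (a : R) (u v : 'cV[R]_n) :
  dotv (a *: u) v = a * dotv u v.
Proof. by rewrite -!(dotvC v) dotvZr. Qed.

Definition dotv_linE := (dotvDl, dotvDr, dotvNl, dotvNr, dotvZl, dotvZr).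

Lemma dotv_mulmxr (R : comNzRingType) m n (A : 'M[R]_(m, n)) u v :
  dotv u (A *m v) = dotv (A^T *m u) v.
Proof. by rewrite /dotv trmx_mul trmxK mulmxA. Qed.

Lemma dotv_col_mx (R : comNzRingType) m n (a c : 'cV[R]_m) (b d : 'cV[R]_n) :
  dotv (col_mx a b) (col_mx c d) = dotv a c + dotv b d.
Proof. by rewrite /dotv tr_col_mx mul_row_col mxE. Qed.

Lemma dotvv_ge0 (R : realDomainType) n (v : 'cV[R]_n) : 0 <= dotv v v.
Proof. by rewrite dotvE; apply: sumr_ge0 => i _; rewrite -expr2 sqr_ge0. Qed.

Lemma sqr_le_dotvv (R : realDomainType) n (v : 'cV[R]_n) i :
  v i 0 ^+ 2 <= dotv v v.
Proof.
rewrite dotvE (bigD1 i) //= expr2 lerDl.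
by apply: sumr_ge0 => j _; rewrite -expr2 sqr_ge0.
Qed.

Lemma dotvv_eq0 (R : realDomainType) n (v : 'cV[R]_n) :
  (dotv v v == 0) = (v == 0).
Proof.
apply/eqP/eqP => [v0 | ->]; last by rewrite /dotv mulmx0 mxE.
apply/matrixP => i j; rewrite ord1 mxE; apply/eqP.
by rewrite -sqrf_eq0 eq_le sqr_ge0 -v0 sqr_le_dotvv.
Qed.

Lemma dotvv_gt0 (R : realDomainType) n (v : 'cV[R]_n) :
  (0 < dotv v v) = (v != 0).
Proof. by rewrite lt_def dotvv_ge0 andbT dotvv_eq0. Qed.

(** Each product [v i 0 * v j 0] is at most [dotv v v] in absolute value, by the squares of the sum
    and the difference of the two entries. *)
Lemma dotv_mulmx_le (R : realFieldType) n (S : 'M[R]_n) (v : 'cV[R]_n) :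
  dotv v (S *m v) <= l1norm S * dotv v v.
Proof.
rewrite dotvE mulr_suml; apply: ler_sum => i _.
rewrite mxE mulr_sumr mulr_suml; apply: ler_sum => j _.
apply: le_trans (ler_norm _) _.
rewrite mulrCA normrM; apply: ler_wpM2l => //.
have [vi vj] := (sqr_le_dotvv v i, sqr_le_dotvv v j).
rewrite ler_norml; apply/andP; split.
  have := sqr_ge0 (v i 0 + v j 0); nra.
have := sqr_ge0 (v i 0 - v j 0); nra.
Qed.

Lemma posdefmxE (R : realType) n (P : 'M[R]_n) :
  posdefmx P <-> P^T = P /\ forall v, v != 0 -> 0 < dotv v (P *m v).
Proof.
by split=> -[symP posP]; split=> // v /posP; rewrite /dotv mulmxA.
Qed.

Lemma posdefmx_unit (R : realType) n (P : 'M[R]_n) :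
  posdefmx P -> P \in unitmx.
Proof.
case/posdefmxE=> symP posP; rewrite -row_free_unit -kermx_eq0.
apply/eqP/row_matrixP => i; rewrite row0; apply/eqP/negPn/negP => ker_i.
have := posP (row i (kermx P))^T.
rewrite trmx_eq0 dotv_mulmxr -trmx_mul -row_mul mulmx_ker row0 trmx0.
by rewrite /dotv trmx0 mul0mx mxE ltxx => /(_ ker_i).
Qed.

Lemma posdefmx_ge0 (R : realType) n (P : 'M[R]_n) v :
  posdefmx P -> 0 <= dotv v (P *m v).
Proof.
case/posdefmxE=> _ posP; have [->|/posP/ltW//] := eqVneq v 0.
by rewrite mulmx0 /dotv mulmx0 mxE.
Qed.

(** * Lyapunov inequalities and Schur stability *)

Lemma Re_mulmx (R : rcfType) n p (v : 'rV[R[i]]_n) (M : 'M[R]_(n, p)) :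
  map_mx (@complex.Re R) (v *m map_mx (real_complex R) M) =
  map_mx (@complex.Re R) v *m M.
Proof.
apply/matrixP => i j; rewrite !mxE raddf_sum /=; apply: eq_bigr => k _.
by rewrite !mxE; case: (v i k) => a b /=; rewrite mulr0 subr0.
Qed.

Lemma Im_mulmx (R : rcfType) n p (v : 'rV[R[i]]_n) (M : 'M[R]_(n, p)) :
  map_mx (@complex.Im R) (v *m map_mx (real_complex R) M) =
  map_mx (@complex.Im R) v *m M.
Proof.
apply/matrixP => i j; rewrite !mxE raddf_sum /=; apply: eq_bigr => k _.
by rewrite !mxE; case: (v i k) => a b /=; rewrite mulr0 add0r.
Qed.

(* For a left eigenvector [a + i b] of [M], add the two decrease conditions
   at [a] and [b]. *)
Lemma lyapunov_schur_stable (R : realType) n (M P : 'M[R]_n) :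
  posdefmx P ->
  (forall w : 'cV_n, w != 0 ->
     dotv (M^T *m w) (P *m (M^T *m w)) < dotv w (P *m w)) ->
  schur_stable M.
Proof.
move=> posP decr z /eigenvalueP[v vM v_neq0].
pose a := (map_mx (@complex.Re R) v)^T; pose b := (map_mx (@complex.Im R) v)^T.
pose p := complex.Re z; pose q := complex.Im z.
have Ma : M^T *m a = p *: a - q *: b.
  rewrite -trmx_mul -Re_mulmx vM; apply/matrixP => i j; rewrite !mxE.
  by rewrite /p /q; case: z {vM p q}  => z1 z2; case: (v _ _).
have Mb : M^T *m b = q *: a + p *: b.
  rewrite -trmx_mul -Im_mulmx vM; apply/matrixP => i j; rewrite !mxE.
  rewrite /p /q; case: z {vM Ma p q} => z1 z2.
  by case: (v _ _) => v1 v2 /=; ring.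
have symP := (posP.1 : P^T = P).
have decr_le w : dotv (M^T *m w) (P *m (M^T *m w)) <= dotv w (P *m w).
  have [->|/decr/ltW//] := eqVneq w 0.
  by rewrite !mulmx0 /dotv !mulmx0 lexx.
have ab_neq0 : (a != 0) || (b != 0).
  rewrite -negb_and; apply: contra v_neq0 => /andP[/eqP a0 /eqP b0].
  apply/eqP/matrixP => i j; apply/eqP.
  have /matrixP/(_ j i) := a0; have /matrixP/(_ j i) := b0.
  by rewrite !mxE eq_complex => -> -> /=; rewrite !eqxx.
have Pba : dotv b (P *m a) = dotv a (P *m b).
  by rewrite dotv_mulmxr symP dotvC.
(* The cross terms [dotv a (P *m b)] cancel in the sum, which leaves the factor [|z|^2]. *)
have {decr} decr_ab :
    (p ^+ 2 + q ^+ 2) * (dotv a (P *m a) + dotv b (P *m b)) <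
    dotv a (P *m a) + dotv b (P *m b).
  have -> : (p ^+ 2 + q ^+ 2) * (dotv a (P *m a) + dotv b (P *m b)) =
      dotv (M^T *m a) (P *m (M^T *m a)) + dotv (M^T *m b) (P *m (M^T *m b)).
    rewrite Ma Mb !mulmxDr !mulmxN -!scalemxAr !dotv_linE Pba; ring.
  case/orP: ab_neq0 => [/decr a_lt | /decr b_lt].
    by apply: ltr_leD.
  by apply: ler_ltD.
have ab_ge0 : 0 <= dotv a (P *m a) + dotv b (P *m b).
  by rewrite addr_ge0 ?posdefmx_ge0.
rewrite normc_def -(rmorph1 (real_complex R)) ltcR -sqrtr1.
rewrite ltr_sqrt ?ltr01 // -/p -/q; nra.
Qed.

(* [P] is the truncated Lyapunov series [sum_(k < N) M^k (M^k)^T]; a partial sum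
   is enough, since [P - M P M^T = 1 - M^N (M^N)^T] telescopes. *)
Lemma schur_stable_lyapunov (R : realType) n (M : 'M[R]_n) :
  schur_stable M ->
  exists2 P : 'M[R]_n, posdefmx P &
    forall w : 'cV_n, dotv (M^T *m w) (P *m (M^T *m w)) + 2^-1 * dotv w w
                      <= dotv w (P *m w).
Proof.
case: n M => [|n] M stabM.
  have z0 (v : 'cV[R]_0) : v = 0 by apply/matrixP => -[].
  exists 0; first by split=> [|v]; rewrite ?trmx0 // (z0 v) eqxx.
  by move=> w; rewrite (z0 w) !mulmx0 /dotv !mulmx0 mxE mulr0 addr0.
(* A norm below 1/2 bounds the remainder [f N w] by a quarter of [dotv w w], hence by half of it;
   the other half is the decrease. *)
have [|N small] := @schur_stable_small_power _ _ M 2^-1 stabM.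
  by rewrite invr_gt0.
pose f k (w : 'cV[R]_n.+1) := dotv ((M ^+ k)^T *m w) ((M ^+ k)^T *m w).
pose P := \sum_(k < N) M ^+ k *m (M ^+ k)^T.
have PE w : dotv w (P *m w) = \sum_(k < N) f k w.
  rewrite mulmx_suml /dotv mulmx_sumr summxE; apply: eq_bigr => k _.
  by rewrite -/(dotv _ _) -mulmxA dotv_mulmxr.
have f_shift k w : f k (M^T *m w) = f k.+1 w.
  by rewrite /f mulmxA -trmx_mul mulmxE -exprS.
have decr w : dotv (M^T *m w) (P *m (M^T *m w)) + 2^-1 * dotv w w
    <= dotv w (P *m w).
  have fN : f N w <= 2^-1 * dotv w w.
    rewrite /f -dotv_mulmxr mulmxA; apply: le_trans (dotv_mulmx_le _ _) _.
    apply: ler_wpM2r; first exact: dotvv_ge0.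
    apply: le_trans (l1normM _ _) _; rewrite l1norm_tr.
    have := l1norm_ge0 (M ^+ N); nra.
  have f0 : f 0%N w = dotv w w by rewrite /f expr0 trmx1 mul1mx.
  rewrite !PE; under eq_bigr do rewrite f_shift.
  have : \sum_(k < N.+1) f k w = f 0%N w + \sum_(k < N) f k.+1 w.
    by rewrite big_ord_recl.
  by rewrite big_ord_recr /= f0 => sumE; lra.
exists P => //; apply/posdefmxE; split=> [|w w_neq0].
  by rewrite /P raddf_sum; apply: eq_bigr => k _; rewrite /= trmx_mul trmxK.
apply: lt_le_trans (decr w); rewrite ltr_wpDl //.
  by rewrite PE; apply: sumr_ge0 => k _; apply: dotvv_ge0.
by rewrite mulr_gt0 ?invr_gt0 ?dotvv_gt0.
Qed.

(** * The quadratic form of the matrix inequality, and sufficiency *)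

(** Both squares can be completed despite the zero diagonal block at [c], because their terms in
    [K^T *m c] alone cancel. *)
Lemma dotv_lmi_block (R : realType) n m T (U : 'M[R]_(m, T))
    (X : 'M[R]_(n, T.+1)) (P : 'M[R]_n) (K : 'M[R]_(m, n)) (beta : R)
    (a b : 'cV_n) (c : 'cV_m) (d : 'cV_n) :
  P^T = P ->
  let v := col_mx a (col_mx b (col_mx c d)) in
  let e := (Xplus X)^T *m a - ((Xminus X)^T *m b + U^T *m c) in
  dotv v ((lmi_block P (K *m P) beta + lmi_data U X *m (lmi_data U X)^T) *m v)
  = dotv a (P *m a) - beta * dotv a a
    - dotv (b + K^T *m c) (P *m (b + K^T *m c))
    + dotv (d + K^T *m c) (P *m (d + K^T *m c)) + dotv e e.
Proof.
move=> symP v e.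
have De : (lmi_data U X)^T *m v = e.
  rewrite /lmi_data !tr_col_mx !mul_row_col !linearN /= !mulNmx.
  by rewrite trmx0 mul0mx addr0 -opprD.
rewrite mulmxDl dotvDr -mulmxA.
rewrite [dotv v (lmi_data U X *m _)]dotv_mulmxr De; congr (_ + _).
rewrite /lmi_block !mul_col_mx !mul_row_col !mul0mx !addr0 !add0r.
rewrite !dotv_col_mx trmx_mul symP mulmxBl mul_scalar_mx !mulNmx -!mulmxA.
set k := K^T *m c.
have Kc w : dotv c (K *m w) = dotv k w by rewrite dotv_mulmxr.
rewrite !mulmxDr !dotv_linE !Kc.
have sw u w : dotv u (P *m w) = dotv w (P *m u).
  by rewrite dotv_mulmxr symP dotvC.
rewrite (sw k b) (sw k d); ring.
Qed.

Lemma possemidefmxE (R : realType) n (S : 'M[R]_n) :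
  possemidefmx S <-> S^T = S /\ forall v, 0 <= dotv v (S *m v).
Proof.
split=> -[symS posS]; split=> // v; have := posS v;
  by rewrite /dotv mulmxA.
Qed.

Lemma lmi_sym (R : realType) n m T (U : 'M[R]_(m, T)) (X : 'M[R]_(n, T.+1))
    (P : 'M[R]_n) (L : 'M[R]_(m, n)) (beta : R) :
  P^T = P ->
  let S := lmi_block P L beta + lmi_data U X *m (lmi_data U X)^T in S^T = S.
Proof.
move=> symP S; rewrite /S linearD /= trmx_mul trmxK; congr (_ + _).
rewrite /lmi_block !tr_col_mx !tr_row_mx !trmx0 linearB /= !linearN /=.
rewrite !trmxK tr_scalar_mx symP.
by do ?rewrite -block_mxEh block_mxEv.
Qed.

Lemma lmi_stabilizes_all (R : realType) n m T (U : 'M[R]_(m, T))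
    (X : 'M[R]_(n, T.+1)) (P : 'M[R]_n) (L : 'M[R]_(m, n)) (beta : R) :
  posdefmx P -> 0 < beta -> stabilization_lmi U X P L beta ->
  stabilizes_all U X (L *m invmx P).
Proof.
move=> posP beta_gt0 /possemidefmxE[_ lmi] A B explAB.
have : L = L *m invmx P *m P by rewrite mulmxKV ?posdefmx_unit.
move: (L *m invmx P) => K LE; set M := A + B *m K.
apply: (lyapunov_schur_stable posP) => w w_neq0.
have := lmi (col_mx w (col_mx (A^T *m w)
  (col_mx (B^T *m w) (- (K^T *m (B^T *m w)))))).
rewrite LE dotv_lmi_block ?posP.1 // addNr.
have -> : (Xplus X)^T *m w -
    ((Xminus X)^T *m (A^T *m w) + U^T *m (B^T *m w)) = 0.
  by rewrite explAB linearD /= !trmx_mul mulmxDl !mulmxA subrr.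
have -> : A^T *m w + K^T *m (B^T *m w) = M^T *m w.
  by rewrite /M linearD /= trmx_mul mulmxDl mulmxA.
rewrite !mulmx0 !dotv0 !addr0.
(* The term in [beta] makes the Lyapunov inequality strict. *)
have : 0 < dotv w w by rewrite dotvv_gt0.
nra.
Qed.

(** * Necessity *)

(* If [f = a + b K] is nonzero, then [As + Bs K + alpha f^T f] is Schur stable
   for every [alpha], although its trace is unbounded in [alpha]. *)
Lemma stabilizing_gain_annihilates (R : realType) n m T (U : 'M[R]_(m, T))
    (X : 'M[R]_(n, T.+1)) As Bs K (a : 'rV_n) (b : 'rV_m) :
  explains U X As Bs -> stabilizes_all U X K ->
  a *m Xminus X + b *m U = 0 -> a + b *m K = 0.
Proof.
move=> expl stabK ab0; set f := a + b *m K.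
have bound (alpha : R) : \tr (As + Bs *m K) + alpha * dotv f^T f^T <= n%:R.
  have -> : \tr (As + Bs *m K) + alpha * dotv f^T f^T =
      \tr ((As + alpha *: (f^T *m a)) + (Bs + alpha *: (f^T *m b)) *m K).
    rewrite mulmxDl addrACA [RHS]mxtraceD; congr (_ + _).
    rewrite -scalemxAl -scalerDr -mulmxA -mulmxDr mxtraceZ mxtrace_mulC.
    by rewrite trace_mx11 /dotv trmxK.
  apply/schur_stable_trace_le/stabK; rewrite /explains !mulmxDl addrACA.
  by rewrite -!scalemxAl -!mulmxA -scalerDr -mulmxDr ab0 mulmx0 scaler0 addr0.
apply/eqP; rewrite -trmx_eq0 -dotvv_eq0; apply/eqP.
set s := dotv _ _ in bound *; set t := \tr _ in bound.
apply/eqP/negPn/negP => s_neq0.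
(* This [alpha] makes the trace equal to [n + 1]. *)
have := bound ((n%:R - t + 1) / s).
by rewrite divfK //; lra.
Qed.

(** By duality: every row vector that annihilates [W] annihilates [col_mx 1 K], so the columns of
    the latter are combinations of those of [W]. The transposes turn this into an inclusion of row
    spaces, tested on the cokernel. *)
Lemma stabilizing_gain_factor (R : realType) n m T (U : 'M[R]_(m, T))
    (X : 'M[R]_(n, T.+1)) As Bs K :
  explains U X As Bs -> stabilizes_all U X K ->
  exists G : 'M_(T, n), Xminus X *m G = 1%:M /\ U *m G = K.
Proof.
move=> expl stabK; pose W := col_mx (Xminus X) U.
have : ((col_mx 1%:M K)^T <= W^T)%MS.
  rewrite submxE; set C := cokermx W^T.
  apply/eqP; apply: trmx_inj; rewrite trmx_mul trmxK trmx0.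
  apply/row_matrixP => i; rewrite row_mul row0 -[row i _]hsubmxK.
  rewrite mul_row_col mulmx1.
  apply: stabilizing_gain_annihilates expl stabK _.
  rewrite -mul_row_col hsubmxK -row_mul.
  by rewrite -[col_mx _ _]trmxK -trmx_mul mulmx_coker trmx0 row0.
case/submxP => D /(congr1 trmx); rewrite trmx_mul !trmxK mul_col_mx.
by case/eq_col_mx => -> ->; exists D^T.
Qed.

Lemma informative_lmi (R : realType) n m T (U : 'M[R]_(m, T))
    (X : 'M[R]_(n, T.+1)) As Bs :
  explains U X As Bs -> informative_for_stabilization U X ->
  exists (P : 'M[R]_n) (L : 'M[R]_(m, n)) (beta : R),
    [/\ posdefmx P, 0 < beta & stabilization_lmi U X P L beta].
Proof.
move=> expl [K stabK].
have [G [XG UG]] := stabilizing_gain_factor expl stabK.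
set M := As + Bs *m K.
have [P posP lyap] := schur_stable_lyapunov (stabK _ _ expl).
have symP : P^T = P := posP.1.
(* [N] carries the cross term between [a] and [e], and [S] collects all that [e] can cost. The
   summand 1 in [lambda] keeps it invertible. *)
move NE: (M *m P *m G^T) => N.
pose S := G *m P *m G^T + 4 *: (N^T *m N).
pose lambda := 1 + l1norm S.
have lambda_gt0 : 0 < lambda by rewrite ltr_pwDl ?l1norm_ge0.
pose eps := lambda^-1.
have eps_gt0 : 0 < eps by rewrite invr_gt0.
(* Of the half of [dotv a a] gained from [lyap], one quarter pays for the cross term and the other
   for [beta]. *)
exists (eps *: P), (K *m (eps *: P)), (eps / 4).
have posPe : posdefmx (eps *: P).
  apply/posdefmxE; split=> [|v]; first by rewrite linearZ /= symP.
  have /posdefmxE[_ posP'] := posP.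
  by rewrite -scalemxAl dotvZr pmulr_rgt0 //; apply: posP'.
split=> //; first by rewrite divr_gt0.
have symPe := posPe.1.
apply/possemidefmxE; split=> [|v]; first exact: lmi_sym.
rewrite -(vsubmxK v) -(vsubmxK (dsubmx v)) -(vsubmxK (dsubmx (dsubmx v))).
rewrite dotv_lmi_block //.
set a := usubmx v; set b := usubmx (dsubmx v).
set c := usubmx (dsubmx (dsubmx v)); set d := dsubmx (dsubmx (dsubmx v)).
set e : 'cV_T := _ - (_ + _).
(* Since [M = X_+ G], applying [G^T] to [e] gives [M^T a - (b + K^T c)]. *)
have -> : b + K^T *m c = M^T *m a - G^T *m e.
  have -> : M = Xplus X *m G by rewrite expl mulmxDl -!mulmxA XG UG mulmx1.
  rewrite /e mulmxBr mulmxDr !mulmxA -!trmx_mul XG UG trmx1 mul1mx.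
  by rewrite subKr.
clearbody e.
rewrite -!scalemxAl !dotvZr.
set y := M^T *m a; set g := G^T *m e.
move: (d + K^T *m c) => h; have h_ge0 := posdefmx_ge0 h posP.
have cross : dotv y (P *m g) = dotv a (N *m e).
  by rewrite -NE /g -!mulmxA [RHS]dotv_mulmxr.
have Pgy : dotv g (P *m y) = dotv y (P *m g).
  by rewrite dotv_mulmxr symP dotvC.
have Se : dotv e (S *m e) = dotv g (P *m g) + 4 * dotv (N *m e) (N *m e).
  rewrite /S mulmxDl -scalemxAl dotvDr dotvZr -!mulmxA.
  rewrite [dotv e (N^T *m _)]dotv_mulmxr trmxK.
  by rewrite [dotv e (G *m _)]dotv_mulmxr.
have bound := dotv_mulmx_le S e.
(* AM-GM for the cross term [2 a . N e]. *)
have square := dotvv_ge0 (a + 4 *: (N *m e)).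
rewrite !dotv_linE (dotvC (N *m e)) in square.
have lyap_a := lyap a; rewrite -/M -/y in lyap_a.
rewrite mulmxBr !dotv_linE Pgy cross.
(* Now every term has the factor [eps], which can be divided out. *)
have {1}-> : dotv e e = eps * (lambda * dotv e e).
  by rewrite mulrA mulVf ?mul1r ?gt_eqF.
have ee_ge0 := dotvv_ge0 e; rewrite /lambda mulrDl mul1r.
set ee := l1norm S * _ in bound *.
rewrite [leRHS](_ : _ = eps * (dotv a (P *m a) - dotv a a / 4
  - (dotv y (P *m y) - 2 * dotv a (N *m e) + dotv g (P *m g))
  + dotv h (P *m h) + (dotv e e + ee))); last by ring.
apply: mulr_ge0; first exact: ltW.
lra.
Qed.

Unset Implicit Arguments.
Set Strict Implicit.

Theorem theorem2 (R : realType) (n m T : nat)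
    (n_gt0 : (0 < n)%N) (m_gt0 : (0 < m)%N) (T_gt0 : (0 < T)%N)
    (As : 'M[R]_n) (Bs : 'M[R]_(n, m))
    (x : 'I_T.+1 -> 'cV[R]_n) (u : 'I_T -> 'cV[R]_m)
    (generated : forall t : 'I_T,
      x (lift ord0 t) = As *m x (widen_ord (leqnSn T) t) + Bs *m u t) :
  let X := state_data x in
  let U := input_data u in
  (informative_for_stabilization U X <->
   exists (P : 'M[R]_n) (L : 'M[R]_(m, n)) (beta : R),
     [/\ posdefmx P, 0 < beta & stabilization_lmi U X P L beta]) /\
  (forall (P : 'M[R]_n) (L : 'M[R]_(m, n)),
     posdefmx P ->
     (exists beta : R, 0 < beta /\ stabilization_lmi U X P L beta) ->
     stabilizes_all U X (L *m invmx P)).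
Proof.
move=> X U; have expl : explains U X As Bs.
  apply/matrixP => i t; move/matrixP/(_ i 0): (generated t).
  by rewrite !mxE => ->; congr (_ + _); apply: eq_bigr => k _; rewrite !mxE.
split; last first.
  by move=> P L posP [beta [beta_gt0 lmi]]; apply: lmi_stabilizes_all lmi.
split=> [|[P [L [beta [posP beta_gt0 lmi]]]]].
  exact: informative_lmi expl.
by exists (L *m invmx P); apply: lmi_stabilizes_all lmi.
Qed.
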